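(* Fix $\kappa>0$. Let $A\in C^0(\mathbb{R},\mathrm{SL}(2,\mathbb{R}))\cap C^2(\mathbb{R},\mathbb{M}^2)$ be a solution of $\ddot A(t)+\kappa A(t)=\lambda(t)\,\mathrm{cof}\,A(t)$. Then one of the following holds: - $A$ is rigid; - $|A|$ is nonconstant and $T$-periodic with some $T>0$; or - $|A(t)|>\sqrt2$ for all $t\in\mathbb{R}$ and $|A(t)|\searrow\sqrt2$ as $t\to\pm\infty$.
   Context: $\mathbb{M}^2$ is the space of real $2\times2$ matrices with norm $|A|=(\mathrm{tr}\,A^\top A)^{1/2}$. $\mathrm{SL}(2,\mathbb{R})=\{A:\det A=1\}$ (on which $|A|\ge\sqrt2$). $Z=\begin{bmatrix}0&-1\\1&0\end{bmatrix}$ and $\mathrm{cof}\,A=ZAZ^\top$ is the cofactor matrix. A solution means that the equation holds for some $\lambda\in C^0(\mathbb{R},\mathbb{R})$ (necessarily $\lambda(t)=2(\kappa-\det\dot A(t))/|A(t)|^2$). A solution is rigid if $|A(t)|$ is constant in $t$. The notation $f(t)\searrow c$ as $t\to\infty$ (respectively $t\to-\infty$) means that $f(t)\to c$ and that, for $|t|$ large, $f$ decreases monotonically as $t$ moves toward $\infty$ (respectively $-\infty$). *)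

(* Defs.v *)
From HB Require Import structures.
From mathcomp Require Import all_boot all_order all_algebra.
From mathcomp Require Import all_classical all_reals all_analysis.
Import Order.TTheory GRing.Theory Num.Theory.
Import numFieldNormedType.Exports.

Set Implicit Arguments.
Unset Strict Implicit.
Unset Printing Implicit Defensive.

Local Open Scope classical_set_scope.
Local Open Scope ring_scope.

(* The library norm `|A| on matrices is the sup norm of the entries; it is used
   here only through the topology and the derivatives, which do not depend on
   the choice of norm. *)
Definition frob (R : realType) (A : 'M[R]_2) : R := Num.sqrt (\tr (A^T *m A)).

Definition SL2 (R : realType) : set 'M[R]_2 := [set A | \det A = 1].

Definition Zmx (R : realType) : 'M[R]_2 :=
  \matrix_(i, j) nth 0 (nth [::] [:: [:: 0; -1]; [:: 1; 0]] i) j.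

Definition cof (R : realType) (A : 'M[R]_2) : 'M[R]_2 :=
  Zmx R *m A *m (Zmx R)^T.

Lemma cof_adj (R : realType) (A : 'M[R]_2) : cof A = (\adj A)^T.
Proof.
apply/matrixP => i j.
rewrite !mxE big_ord_recl big_ord1 !mxE !big_ord_recl !big_ord0 !mxE.
rewrite /cofactor det_mx11 !mxE.
have E : forall a b : 'I_2, a = b :> nat -> a = b by move=> ? ?; exact: val_inj.
case: i => [[|[|//]] ?]; case: j => [[|[|//]] ?];
  rewrite /= ?(mul0r, mulr0, mul1r, mulr1, mulN1r, mulrN1, addr0, add0r, opprK,
    expr0, expr1, sqrrN, expr1n, mulNr, mulrN) ?addn0 ?addn1 ?expr2
    ?(mulN1r, mulrN1, opprK, mul1r, mulr1);
  try (congr (- _)); try congr (A _ _); exact: E.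
Qed.

Definition C2 (R : realType) (V : normedModType R) (f : R -> V) : Prop :=
  [/\ continuous f,
      forall t, derivable f t 1,
      continuous (f^`())%classic,
      forall t, derivable (f^`())%classic t 1
    & continuous (f^`(2))%classic].

Definition solution (R : realType) (kappa : R) (A : R -> 'M[R]_2) : Prop :=
  exists lambda : R -> R, continuous lambda /\
    forall t, (A^`(2))%classic t + kappa *: A t = lambda t *: cof (A t).

Definition constant_fun (R : realType) (f : R -> R) : Prop :=
  exists c, forall t, f t = c.

Definition rigid (R : realType) (A : R -> 'M[R]_2) : Prop :=
  constant_fun (fun t => frob (A t)).

Definition decreases_to_pinfty (R : realType) (f : R -> R) (c : R) : Prop :=
  f t @[t --> +oo] --> c /\
  exists M : R, forall s t, M < s -> s < t -> f t < f s.

(* Decreasing as t moves toward -oo, i.e. increasing as a function of t. *)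
Definition decreases_to_ninfty (R : realType) (f : R -> R) (c : R) : Prop :=
  f t @[t --> -oo] --> c /\
  exists M : R, forall s t, t < M -> s < t -> f s < f t.

(* Main.v *)
Require Import Defs.
From HB Require Import structures.
From mathcomp Require Import all_boot all_order all_algebra.
From mathcomp Require Import all_classical all_reals all_analysis.
From mathcomp Require Import ring lra.
Import Order.TTheory GRing.Theory Num.Theory.
Import numFieldNormedType.Exports.

Local Open Scope classical_set_scope.
Local Open Scope ring_scope.

(** Write A = [a b; c d] and set z = (a + d) + i (c - b) and
    w = (a - d) + i (b + c).  Passing to the cofactor matrix fixes z and negates
    w, so the equation splits into two planar central motions
      z'' = (lambda - kappa) z   and   w'' = - (lambda + kappa) w,
    while det A = 1 reads |z|^2 - |w|^2 = 4.  With f = |A|^2 this gives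
    |z|^2 = f + 2 and |w|^2 = f - 2.  The angular momenta m of z and n of w
    are conserved, and so is the energy K = |A'|^2 + kappa f; eliminating z and
    w ([central_motion_radial]) yields an autonomous scalar equation for f
    alone,
      f f'^2 / 2 = P(f)   and   f f'' + f'^2 / 2 = P'(f),
    where P(x) = 2 (x^2 - 4) (K - kappa x) - m^2 (x - 2) - n^2 (x + 2).

    The initial value problem for the second-order equation has at most one
    solution ([radial_unique], by a Gronwall estimate), and reflecting time
    preserves the equation, so f is symmetric about every zero of f'.  If f'
    vanishes at two distinct times, f is invariant under the composition of two
    reflections, a translation, and hence is periodic ([radial_periodic]).

    Otherwise f is strictly monotone on each of two complementary half-lines.
    Being bounded, it has a limit c at infinity, where f' and f'' must tend to
    0; so c is a double root of P and P(x) = 2 (x - c)^2 (K - 2 kappa c - kappa x).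
    Since P(f) > 0 somewhere and f >= 2, the linear factor is positive
    at 2, whereas P(2) = - 4 n^2 <= 0.  Hence c = 2 ([radial_limit]), and since
    f >= 2 the convergence is strictly decreasing.  Reflecting time treats
    minus infinity. *)

(** * Calculus on the real line *)

Lemma is_derive1_continuous {R : realType} {f f1 : R -> R} :
  (forall t : R, is_derive t (1 : R) f (f1 t)) -> continuous f.
Proof.
move=> df t; apply/differentiable_continuous/derivable1_diffP.
by case: (df t).
Qed.

Lemma MVT_global {R : realType} {f f1 : R -> R} {a b : R} : a < b ->
  (forall t : R, is_derive t (1 : R) f (f1 t)) ->
  exists2 c, a < c < b & f b - f a = f1 c * (b - a).
Proof.
move=> ab df; have [|c] := MVT ab (fun x _ => df x).
  apply: continuous_subspaceT; exact: is_derive1_continuous df.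
by rewrite in_itv/=; exists c.
Qed.

Lemma is_derive_reflect {R : realType} {f : R -> R} {c t d : R} :
  is_derive (c - t) (1 : R) f d -> is_derive t (1 : R) (fun s => f (c - s)) (- d).
Proof.
move=> df.
have dr : is_derive t (1 : R) (fun s : R => c - s) (- 1).
  by apply: is_derive_eq; rewrite add0r mul1r.
have := @is_derive1_comp R f (fun s : R => c - s) t d (- 1) df dr.
by rewrite mulrN1.
Qed.

(** Gronwall's inequality with zero initial value, in both time directions. *)
Lemma gronwall_zero {R : realType} {N N1 : R -> R} {C t0 : R} :
  (forall t : R, is_derive t (1 : R) N (N1 t)) -> (forall t, 0 <= N t) ->
  (forall t, `|N1 t| <= C * N t) -> N t0 = 0 -> forall t, N t = 0.
Proof.
wlog suff H : N N1 t0 / (forall t : R, is_derive t (1 : R) N (N1 t)) ->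
    (forall t, 0 <= N t) -> (forall t, `|N1 t| <= C * N t) -> N t0 = 0 ->
    forall t, t0 < t -> N t = 0.
  (* Times before [t0] are reached by reflecting [N]. *)
  move=> dN N0 NC Nt0 t; case: (ltgtP t0 t) => [|tt0|<-//]; first exact: (H N N1).
  rewrite -[t](subKr 0).
  apply: (H (fun s => N (0 - s)) (fun s => - N1 (0 - s)) (0 - t0)) => //.
  - by move=> s; exact: is_derive_reflect.
  - by move=> s; rewrite normrN.
  - by rewrite subKr.
  - by rewrite !sub0r ltrN2.
move=> dN N0 NC Nt0 t t0t.
(* [N * exp (- C s)] is nonincreasing after [t0]. *)
have dM s : is_derive s (1 : R) (fun s => N s * expR (- C * s))
    ((N1 s - C * N s) * expR (- C * s)).
  have dl : is_derive s (1 : R) (fun s : R => - C * s) (- C).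
    by apply: is_derive_eq; rewrite /GRing.scale /=; ring.
  have de : is_derive s (1 : R) (fun s : R => expR (- C * s)) (expR (- C * s) * - C).
    exact: (@is_derive1_comp R expR (fun s : R => - C * s)).
  apply: is_derive_eq; rewrite /GRing.scale /=; ring.
have [c _] := MVT_global t0t dM.
rewrite Nt0 mul0r subr0 => E.
have : N t * expR (- C * t) <= 0.
  rewrite E pmulr_lle0 ?subr_gt0// pmulr_lle0 ?expR_gt0//.
  by rewrite subr_le0 (le_trans (ler_norm _)).
rewrite pmulr_lle0 ?expR_gt0// => Nt; apply/eqP; by rewrite eq_le Nt N0.
Qed.

(** If [f] converges, its derivative cannot stay away from 0.  Only the square of
    the derivative is assumed to converge, so that no sign has to be known. *)
Lemma sqr_derive_lim0 {R : realType} {f f1 : R -> R} {c l : R} :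
  (forall t : R, is_derive t (1 : R) f (f1 t)) ->
  f t @[t --> +oo] --> c -> (f1 t) ^+ 2 @[t --> +oo] --> l -> l = 0.
Proof.
move=> df fc f1l; apply/eqP; apply: contraT => l0.
have e0 : 0 < `|l| / 2 by rewrite divr_gt0// normr_gt0.
have [M [_ HM]] : \forall t \near +oo, `|l| / 2 < f1 t ^+ 2.
  move/cvgrPdist_lt : f1l => /(_ _ e0); apply: filterS => t ht.
  have := ler_normD (l - f1 t ^+ 2) (f1 t ^+ 2); rewrite subrK.
  by rewrite (ger0_norm (sqr_ge0 _)); lra.
have fD : (f (t + 1) - f t) ^+ 2 @[t --> +oo] --> (c - c) ^+ 2.
  have h : f (t + 1) - f t @[t --> +oo] --> c - c.
    by apply: cvgB => //; rewrite cvg_shiftr.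
  by under eq_fun do rewrite expr2; rewrite expr2; exact: cvgM.
rewrite subrr expr0n/= in fD.
have [M' [_ HM']] : \forall t \near +oo, (f (t + 1) - f t) ^+ 2 < `|l| / 2.
  move/cvgrPdist_lt : fD => /(_ _ e0); apply: filterS => t.
  by rewrite sub0r normrN (ger0_norm (sqr_ge0 _)).
pose t := Num.max M M' + 1.
have tM : M < t by rewrite /t ltr_pwDr// le_max lexx.
have tM' : M' < t by rewrite /t ltr_pwDr// le_max lexx orbT.
(* The increment of [f] over a unit interval is a value of [f1]. *)
have [|x /andP[tx _] E] := @MVT_global R f f1 t (t + 1) _ df; first by rewrite ltrDl.
have := HM' _ tM'; have := HM x (lt_trans tM tx).
rewrite E; have -> : t + 1 - t = 1 by ring.
by rewrite mulr1; lra.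
Qed.

Lemma nonvanishing_sign {R : realType} {g : R -> R} {M : R} :
  continuous g -> (forall t, M < t -> g t != 0) ->
  (forall t, M < t -> 0 < g t) \/ (forall t, M < t -> g t < 0).
Proof.
move=> cg g0.
have same s t : M < s -> s <= t -> 0 < g s * g t.
  move=> Ms st; rewrite ltNge; apply/negP => gst.
  have [||c] := @IVT R g s t 0 st.
  - exact: continuous_subspaceT.
  - rewrite ge_min le_max.
    by case: (ltgtP (g s) 0) => // gs; case: (ltgtP (g t) 0) => //= gt; nra.
  - rewrite in_itv/= => /andP[sc _] /eqP; apply/negP; apply: g0.
    exact: lt_le_trans sc.
have [gp|gn] := ltP 0 (g (M + 1)); [left|right] => t Mt.
  have Mm : M < M + 1 by rewrite ltrDl.
  case: (leP t (M + 1)) => [tM|/ltW tM].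
    by have := same _ _ Mt tM; rewrite pmulr_lgt0.
  by have := same _ _ Mm tM; rewrite pmulr_rgt0.
have gn' : g (M + 1) < 0 by rewrite lt_neqAle gn g0// ltrDl.
have Mm : M < M + 1 by rewrite ltrDl.
case: (leP t (M + 1)) => [tM|/ltW tM].
  by have := same _ _ Mt tM; rewrite nmulr_lgt0.
by have := same _ _ Mm tM; rewrite nmulr_rgt0.
Qed.

Lemma derive_pos_lt {R : realType} {f f1 : R -> R} {M : R} :
  (forall t : R, is_derive t (1 : R) f (f1 t)) ->
  (forall t, M < t -> 0 < f1 t) ->
  forall s t, M <= s -> s < t -> f s < f t.
Proof.
move=> df f1p s t Ms st; have [c /andP[sc _] E] := MVT_global st df.
by rewrite -subr_gt0 E mulr_gt0 ?subr_gt0// f1p// (le_lt_trans Ms).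
Qed.

Lemma derive_neg_lt {R : realType} {f f1 : R -> R} {M : R} :
  (forall t : R, is_derive t (1 : R) f (f1 t)) ->
  (forall t, M < t -> f1 t < 0) ->
  forall s t, M <= s -> s < t -> f t < f s.
Proof.
move=> df f1n s t Ms st; have [c /andP[sc _] E] := MVT_global st df.
by rewrite -subr_lt0 E nmulr_rlt0 ?subr_gt0// f1n// (le_lt_trans Ms).
Qed.

Lemma tail_nondecreasing_cvg {R : realType} {f : R -> R} {M B : R} :
  (forall s t, M <= s -> s < t -> f s <= f t) -> (forall t, f t <= B) ->
  exists c : R, f t @[t --> +oo] --> c.
Proof.
(* [f], frozen before [M], is monotone on the whole line. *)
move=> ndf fB; pose g t := f (Num.max M t).
exists (sup (range g)).
have : g t @[t --> +oo] --> sup (range g).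
  apply: nondecreasing_cvgr; last by exists B => _ [t _ <-]; exact: fB.
  move=> s t st; rewrite /g.
  have : Num.max M s <= Num.max M t.
    by rewrite ge_max !le_max lexx st orbT.
  rewrite le_eqVlt => /predU1P[->//|]; apply: ndf.
  by rewrite le_max lexx.
apply: cvg_trans; apply: near_eq_cvg; exists M; split; first exact: num_real.
by move=> t Mt; rewrite /g max_r// ltW.
Qed.

(** * The scalar equation of the squared norm *)

(** The polynomial [P] with [f * f' ^+ 2 / 2 = P f], where [f] is the square of
    the norm of a solution: [k] is the coefficient of the linear term, [K] the
    energy, [l1] and [l2] the squared angular momenta. *)
Definition cubic {R : realType} (k K l1 l2 x : R) : R :=
  2 * (x ^+ 2 - 4) * (K - k * x) - l1 * (x - 2) - l2 * (x + 2).

(** The derivative of [cubic] in its last argument. *)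
Definition dcubic {R : realType} (k K l1 l2 x : R) : R :=
  4 * x * (K - k * x) - 2 * k * (x ^+ 2 - 4) - l1 - l2.

Lemma is_derive_cubic {R : realType} (k K l1 l2 x : R) :
  is_derive x (1 : R) (cubic k K l1 l2) (dcubic k K l1 l2 x).
Proof.
by apply: is_derive_eq; rewrite /GRing.scale /= /dcubic; ring.
Qed.

Lemma is_derive_dcubic {R : realType} (k K l1 l2 x : R) :
  is_derive x (1 : R) (dcubic k K l1 l2) (4 * K - 12 * k * x).
Proof.
by apply: is_derive_eq; rewrite /GRing.scale /= ; ring.
Qed.

(** The factorization of [cubic] at a double root [c], by Taylor expansion at [c]. *)
Lemma cubic_double_root {R : realType} {k K l1 l2 c : R} (x : R) :
  cubic k K l1 l2 c = 0 -> dcubic k K l1 l2 c = 0 ->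
  cubic k K l1 l2 x = (x - c) ^+ 2 * (2 * K - 4 * k * c - 2 * k * x).
Proof.
move=> c0 d0.
transitivity (cubic k K l1 l2 c + dcubic k K l1 l2 c * (x - c) +
  (x - c) ^+ 2 * (2 * K - 4 * k * c - 2 * k * x)).
  by rewrite /cubic /dcubic; ring.
by rewrite c0 d0; ring.
Qed.

(** [f], with first and second derivatives [f1] and [f2], satisfies the equation
    of motion of the squared norm, in first-order and in second-order form.  The
    second-order form is not a consequence of the first-order one where [f1]
    vanishes (a constant [f] at a simple root of [cubic] satisfies only
    the first-order form), so both are recorded. *)
Record radial {R : realType} (k K l1 l2 : R) (f f1 f2 : R -> R) : Prop := {
  radial_d1 : forall t : R, is_derive t (1 : R) f (f1 t) ;
  radial_d2 : forall t : R, is_derive t (1 : R) f1 (f2 t) ;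
  radial_ge2 : forall t, 2 <= f t ;
  radial_le : forall t, k * f t <= K ;
  radial_order1 : forall t, f t * f1 t ^+ 2 / 2 = cubic k K l1 l2 (f t) ;
  radial_order2 : forall t,
    f t * f2 t + f1 t ^+ 2 / 2 = dcubic k K l1 l2 (f t) }.

Arguments radial_d1 {R k K l1 l2 f f1 f2}.
Arguments radial_d2 {R k K l1 l2 f f1 f2}.
Arguments radial_ge2 {R k K l1 l2 f f1 f2}.
Arguments radial_le {R k K l1 l2 f f1 f2}.
Arguments radial_order1 {R k K l1 l2 f f1 f2}.
Arguments radial_order2 {R k K l1 l2 f f1 f2}.

Section Radial.
Context {R : realType} {k K l1 l2 : R}.
Hypotheses (k0 : 0 < k) (l10 : 0 <= l1) (l20 : 0 <= l2).

(** The equation is autonomous and even in time, hence invariant under the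
    reflection [t |-> c - t]. *)
Lemma radial_reflect {f f1 f2 : R -> R} (c : R) : radial k K l1 l2 f f1 f2 ->
  radial k K l1 l2 (fun t => f (c - t)) (fun t => - f1 (c - t))
    (fun t => f2 (c - t)).
Proof.
move=> [d1 d2 ge2 le o1 o2]; split => t //.
- exact: is_derive_reflect.
- have dr := is_derive_reflect (d2 (c - t)).
  by apply: is_derive_eq; rewrite opprK.
- by rewrite sqrrN.
- by rewrite sqrrN.
Qed.

(** The energy bounds [f] by [K / k], and the two equations then bound its
    derivatives; this makes the second-order equation Lipschitz along solutions. *)
Lemma radial_bounded {f f1 f2 : R -> R} : radial k K l1 l2 f f1 f2 ->
  exists2 B : R, 0 <= B & forall t, `|f1 t| <= B /\ `|f2 t| <= B.
Proof.
move=> [d1 d2 ge2 le o1 o2].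
have [kp l1p l2p] := And3 k0 l10 l20.
have [B fB] : exists B, forall t, f t <= B.
  by exists (K / k) => t; rewrite ler_pdivlMr// mulrC.
have K0 : 0 <= K.
  by rewrite (le_trans _ (le 0))// mulr_ge0 ?(ltW k0)// (le_trans _ (ge2 0)).
have f1B t : f1 t ^+ 2 <= 4 * B * K.
  have := o1 t; have := le t; have := ge2 t; have := fB t.
  rewrite /cubic; move: (f t) (f1 t) => x y xB x2 kx E.
  have kx0 : 0 <= k * x by rewrite mulr_ge0 ?(ltW k0)//; lra.
  have h1 : (x ^+ 2 - 4) * (K - k * x) <= x ^+ 2 * K.
    by apply: ler_pM; nra.
  have h2 : 0 <= l1 * (x - 2) by rewrite mulr_ge0//; lra.
  have h3 : 0 <= l2 * (x + 2) by rewrite mulr_ge0//; lra.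
  have h : x * y ^+ 2 <= x * (4 * x * K) by nra.
  have : y ^+ 2 <= 4 * x * K by rewrite -(@ler_pM2l _ x)//; lra.
  move=> /le_trans; apply; rewrite ler_wpM2r//; lra.
have B0 : 0 <= B by rewrite (le_trans _ (fB 0))// (le_trans _ (ge2 0)).
have BK : 0 <= B * K by rewrite mulr_ge0.
exists (1 + 20 * (B * K) + l1 + l2 + 8 * k) => [|t]; first by lra.
have f1Bt := f1B t; clear f1B; split.
  rewrite (@le_trans _ _ (1 + f1 t ^+ 2))//; last by lra.
  by rewrite -(real_normK (num_real (f1 t))); have := normr_ge0 (f1 t); nra.
have := o2 t; have := le t; have := ge2 t; have := fB t; have := f1Bt; clear f1Bt.
have := sqr_ge0 (f1 t).
rewrite /dcubic; move: (f t) (f1 t ^+ 2) (f2 t) => x y z y0 yB xB x2 kx E.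
have kx0 : 0 <= k * x by rewrite mulr_ge0 ?(ltW k0)//; lra.
have h1 : 0 <= x * (K - k * x) by rewrite mulr_ge0//; lra.
have h2 : x * (K - k * x) <= B * K by apply: ler_pM; lra.
have h3 : k * x * x <= K * B by apply: ler_pM; lra.
have h4 : 0 <= k * x * x by rewrite mulr_ge0//; lra.
have h : `|x * z| <= 1 + 20 * (B * K) + l1 + l2 + 8 * k.
  rewrite ler_norml; apply/andP; split; nra.
apply: le_trans h; rewrite normrM ler_peMl// ger0_norm; lra.
Qed.

Lemma radial_unique {f f1 f2 g g1 g2 : R -> R} {t0 : R} :
  radial k K l1 l2 f f1 f2 -> radial k K l1 l2 g g1 g2 ->
  f t0 = g t0 -> f1 t0 = g1 t0 -> f =1 g.
Proof.
move=> rf rg fg0 fg1; have kp := k0.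
have [B B0 bg] := radial_bounded rg.
have [B' B'0 bf] := radial_bounded rf.
have K0 : 0 <= K.
  rewrite (le_trans _ (radial_le rf 0))// mulr_ge0 ?(ltW k0)//.
  by rewrite (le_trans _ (radial_ge2 rf 0)).
pose D := 16 * K + B + B'.
pose N t := (f t - g t) ^+ 2 + (f1 t - g1 t) ^+ 2.
pose N1 t := 2 * (f t - g t) * (f1 t - g1 t) +
  2 * (f1 t - g1 t) * (f2 t - g2 t).
have dN (t : R) : is_derive t (1 : R) N (N1 t).
  have := radial_d1 rf t; have := radial_d1 rg t.
  have := radial_d2 rf t; have := radial_d2 rg t.
  move=> ? ? ? ?.
  by apply: is_derive_eq; rewrite /N1 /GRing.scale/=; ring.
have NC t : `|N1 t| <= (1 + 3 * D) * N t.
  have [bg1 bg2] := bg t; have [bf1 bf2] := bf t.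
  have := radial_ge2 rf t; have := radial_ge2 rg t.
  have := radial_le rf t; have := radial_le rg t.
  have := radial_order2 rf t.
  have := radial_order2 rg t.
  rewrite /N1 /N /dcubic.
  move: bg1 bg2 bf1 bf2.
  move: (f t) (f1 t) (f2 t) (g t) (g1 t) (g2 t) => x x1 x2 y y1 y2.
  move=> by1 by2 bx1 bx2 Ey Ex ky kx y_ge x_ge.
  (* The difference of the two second-order equations, linearized. *)
  have E : x * (x2 - y2) = (x - y) * (4 * K - 6 * (k * x) - 6 * (k * y) - y2)
      - (x1 - y1) * ((x1 + y1) / 2) by nra.
  have kx0 : 0 <= k * x by rewrite mulr_ge0 ?(ltW k0)//; lra.
  have ky0 : 0 <= k * y by rewrite mulr_ge0 ?(ltW k0)//; lra.
  have h : `|x2 - y2| <= D * (`|x - y| + `|x1 - y1|).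
    apply: (@le_trans _ _ (`|x * (x2 - y2)|)).
      by rewrite normrM ler_peMl// ger0_norm; lra.
    rewrite E [D * _]mulrDr (le_trans (ler_normB _ _))// lerD// normrM mulrC.
      rewrite ler_wpM2r//.
      rewrite /D ler_norml; move: by2; rewrite ler_norml; lra.
    rewrite ler_wpM2r// /D ler_norml; move: by1 bx1; rewrite !ler_norml; lra.
  rewrite (le_trans (ler_normD _ _))// !normrM [`|2|]ger0_norm//.
  rewrite -(real_normK (num_real (x - y))) -(real_normK (num_real (x1 - y1))).
  have D0 : 0 <= D by rewrite /D; lra.
  move: h (normr_ge0 (x - y)) (normr_ge0 (x1 - y1)).
  move: (`|x2 - y2|) (`|x - y|) (`|x1 - y1|) => c a b h a0 b0.
  have h1 : b * c <= b * (D * (a + b)) by rewrite ler_wpM2l.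
  have h2 : 0 <= D * (a - b) ^+ 2 by rewrite mulr_ge0// sqr_ge0.
  have h3 : 0 <= (a - b) ^+ 2 by rewrite sqr_ge0.
  have h4 : 0 <= D * a ^+ 2 by rewrite mulr_ge0// sqr_ge0.
  nra.
move=> t; have : N t = 0.
  apply: (gronwall_zero dN _ NC (t0 := t0)) => [s|].
    by rewrite addr_ge0// sqr_ge0.
  by rewrite /N fg0 fg1 !subrr expr0n addr0.
move/eqP; rewrite paddr_eq0 ?sqr_ge0// => /andP[+ _].
by rewrite sqrf_eq0 subr_eq0 => /eqP.
Qed.

(** A nonstationary end of a solution can only converge to 2. *)
Lemma radial_limit {f f1 f2 : R -> R} {c M : R} :
  radial k K l1 l2 f f1 f2 ->
  f t @[t --> +oo] --> c -> (forall t, M < t -> f1 t != 0) -> c = 2.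
Proof.
move=> [d1 d2 ge2 le o1 o2] fc f1M; have kp := k0; have l2p := l20.
have c2 : 2 <= c by apply: cvgr_to_ge fc _; exact: nearW.
have c0 : c != 0 by apply: lt0r_neq0; lra.
have Vc : (f t)^-1 @[t --> +oo] --> c^-1 by exact: cvgV.
have fn0 t : f t != 0 by apply: lt0r_neq0; have := ge2 t; lra.
have cubic_c : cubic k K l1 l2 (f t) @[t --> +oo] --> cubic k K l1 l2 c.
  apply: (cvg_comp _ (cubic k K l1 l2) fc).
  exact: (is_derive1_continuous (is_derive_cubic k K l1 l2)).
have dcubic_c : dcubic k K l1 l2 (f t) @[t --> +oo] --> dcubic k K l1 l2 c.
  apply: (cvg_comp _ (dcubic k K l1 l2) fc).
  exact: (is_derive1_continuous (is_derive_dcubic k K l1 l2)).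
have f1E t : f1 t ^+ 2 = 2 * cubic k K l1 l2 (f t) * (f t)^-1.
  by rewrite -o1; field.
have f1c : f1 t ^+ 2 @[t --> +oo] --> 2 * cubic k K l1 l2 c * c^-1.
  under eq_fun do rewrite f1E.
  by apply: cvgM => //; apply: cvgM => //; exact: cvg_cst.
have cc0 : cubic k K l1 l2 c = 0.
  have := sqr_derive_lim0 d1 fc f1c => /eqP.
  by rewrite !mulf_eq0 invr_eq0 (negbTE c0) pnatr_eq0/= orbF => /eqP.
rewrite cc0 mulr0 mul0r in f1c.
have f2E t : f2 t = (dcubic k K l1 l2 (f t) - f1 t ^+ 2 / 2) * (f t)^-1.
  by rewrite -o2; field.
have f2c : f2 t @[t --> +oo] --> dcubic k K l1 l2 c * c^-1.
  under eq_fun do rewrite f2E.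
  apply: cvgM => //; rewrite -[dcubic _ _ _ _ c]subr0; apply: cvgB => //.
  by rewrite -(mul0r (2^-1)); apply: cvgM => //; exact: cvg_cst.
have f10 : f1 t @[t --> +oo] --> (0 : R).
  apply/norm_cvg0P; rewrite -sqrtr0.
  under eq_fun do rewrite -sqrtr_sqr.
  by apply: (cvg_comp _ _ f1c); exact: sqrt_continuous.
have dc0 : dcubic k K l1 l2 c = 0.
  have f22 : f2 t ^+ 2 @[t --> +oo] --> (dcubic k K l1 l2 c * c^-1) ^+ 2.
    by under eq_fun do rewrite expr2; rewrite expr2; exact: cvgM.
  have /eqP := sqr_derive_lim0 d2 f10 f22.
  by rewrite sqrf_eq0 mulf_eq0 invr_eq0 (negbTE c0) orbF => /eqP.
apply/eqP; apply: contraT => cn2.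
have tM : M < M + 1 by rewrite ltrDl.
(* [cubic] is positive at [f (M + 1)], so its decreasing linear factor is
   positive there and a fortiori at 2; this contradicts [cubic 2 = - 4 * l2]. *)
have := ge2 (M + 1); have := o1 (M + 1).
rewrite (cubic_double_root _ cc0 dc0) => E fM2.
have P1 : 0 < (f (M + 1) - c) ^+ 2 *
    (2 * K - 4 * k * c - 2 * k * f (M + 1)).
  have s1 : 0 < f1 (M + 1) ^+ 2 by rewrite exprn_even_gt0//= f1M.
  rewrite -E divr_gt0// mulr_gt0//; lra.
have P2 : 0 < 2 * K - 4 * k * c - 2 * k * f (M + 1).
  move: P1; have := sqr_ge0 (f (M + 1) - c); rewrite le_eqVlt => /predU1P[<-|h].
    by rewrite mul0r ltxx.
  by rewrite pmulr_rgt0.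
have P3 : 0 < (2 - c) ^+ 2 * (2 * K - 4 * k * c - 2 * k * 2).
  have s1 : 0 < (2 - c) ^+ 2 by rewrite exprn_even_gt0//= subr_eq0 eq_sym.
  rewrite mulr_gt0//; nra.
move: P3; rewrite -(cubic_double_root 2 cc0 dc0) /cubic; lra.
Qed.

Lemma radial_asymptotics {f f1 f2 : R -> R} {M : R} :
  radial k K l1 l2 f f1 f2 -> (forall t, M < t -> f1 t != 0) ->
  [/\ f t @[t --> +oo] --> (2 : R),
      forall s t, M <= s -> s < t -> f t < f s & forall t, M <= t -> 2 < f t].
Proof.
move=> rf f1M; have kp := k0; case: (rf) => d1 d2 ge2 le o1 o2.
have [pos|neg] := nonvanishing_sign (is_derive1_continuous d2) f1M.
  (* A strictly increasing [f] would converge to a limit greater than 2. *)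
  have inc := derive_pos_lt d1 pos.
  have [||c fc] := @tail_nondecreasing_cvg R f M (K / k).
  - by move=> s t Ms st; apply/ltW/inc.
  - by move=> t; rewrite ler_pdivlMr// mulrC.
  have c2 := radial_limit rf fc f1M.
  have : f (M + 1) <= c.
    apply: (cvgr_to_ge fc); exists (M + 1); split; first exact: num_real.
    by move=> t Mt; apply/ltW/inc => //; rewrite lerDl.
  have := inc M (M + 1) (lexx _); rewrite ltrDl => /(_ ltr01).
  have := ge2 M; rewrite c2; lra.
have dec := derive_neg_lt d1 neg.
have [||c fc] := @tail_nondecreasing_cvg R (fun t => - f t) M 0.
- by move=> s t Ms st; rewrite lerN2; apply/ltW/dec.
- by move=> t; rewrite oppr_le0 (le_trans _ (ge2 t)).
have fc' : f t @[t --> +oo] --> - c.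
  by rewrite -[f]opprK; exact: cvgN.
have c2 := radial_limit rf fc' f1M.
rewrite c2 in fc'; split => // t Mt.
have := dec t (t + 1) Mt; rewrite ltrDl => /(_ ltr01).
by apply: le_lt_trans; exact: ge2.
Qed.

Lemma radial_periodic {f f1 f2 : R -> R} {a b : R} :
  radial k K l1 l2 f f1 f2 -> f1 a = 0 -> f1 b = 0 ->
  periodic f (2 * (b - a)).
Proof.
move=> rf fa fb.
have sym c : f1 c = 0 -> forall t, f (2 * c - t) = f t.
  move=> fc t; apply/esym.
  apply: (radial_unique (t0 := c) rf (radial_reflect (2 * c) rf)).
    by congr f; ring.
  have -> : 2 * c - c = c by ring.
  by rewrite fc oppr0.
move=> t; rewrite -(sym a fa t) -(sym b fb (2 * a - t)); congr f; ring.
Qed.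

(** Stationary solutions fall under the first alternative. *)
Lemma radial_dichotomy {f f1 f2 : R -> R} :
  radial k K l1 l2 f f1 f2 ->
  (exists2 T, 0 < T & periodic f T) \/
  [/\ forall t, 2 < f t,
      f t @[t --> +oo] --> (2 : R),
      f t @[t --> -oo] --> (2 : R) &
      exists M, (forall s t, M <= s -> s < t -> f t < f s) /\
                (forall s t, t <= M -> s < t -> f s < f t)].
Proof.
move=> rf.
have [[a [b [ab fa fb]]]|nz] := EM (exists a b, [/\ a < b, f1 a = 0 & f1 b = 0]).
  left; exists (2 * (b - a)); last exact: (radial_periodic rf).
  by rewrite mulr_gt0// subr_gt0.
right.
have [M f1M] : exists M, forall t, t != M -> f1 t != 0.
  have [[a fa]|n0] := EM (exists a, f1 a = 0).
    exists a => t ta; apply/eqP => ft; apply: nz.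
    by case: (ltgtP t a) ta => // ta _; [exists t, a|exists a, t].
  by exists 0 => t _; apply/eqP => ft; apply: n0; exists t.
have [|fy decy gty] := @radial_asymptotics f f1 f2 M rf.
  by move=> t Mt; rewrite f1M// gt_eqF.
have [|fNy decNy gtNy] :=
    @radial_asymptotics _ _ _ (- M) (radial_reflect 0 rf).
  by move=> t Mt; rewrite oppr_eq0 f1M// sub0r lt_eqF// ltrNl.
split => //.
- move=> t; case: (leP M t) => [|/ltW tM]; first exact: gty.
  by have := gtNy (- t); rewrite sub0r opprK lerN2; exact.
- under eq_fun do rewrite -[X in f X]opprK -[- - _]add0r.
  by apply: (cvg_comp _ (fun t => f (0 - t)) _ fNy); rewrite ninftyN.
- exists M; split => // s t tM st.
  by have := decNy (- t) (- s); rewrite !sub0r !opprK lerN2 ltrN2; exact.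
Qed.

End Radial.

(** * From matrices to the scalar equation *)

(** Two planar motions [(p, q)] and [(r, s)] in central force fields, coupled by
    the constraint that their squared radii differ by 4. *)
Lemma central_motion_radial {R : realType} {k : R}
    {p p1 p2 q q1 q2 r r1 r2 s s1 s2 lam : R -> R} :
  (forall t : R, is_derive t (1 : R) p (p1 t)) ->
  (forall t : R, is_derive t (1 : R) p1 (p2 t)) ->
  (forall t : R, is_derive t (1 : R) q (q1 t)) ->
  (forall t : R, is_derive t (1 : R) q1 (q2 t)) ->
  (forall t : R, is_derive t (1 : R) r (r1 t)) ->
  (forall t : R, is_derive t (1 : R) r1 (r2 t)) ->
  (forall t : R, is_derive t (1 : R) s (s1 t)) ->
  (forall t : R, is_derive t (1 : R) s1 (s2 t)) ->
  (forall t, p2 t = (lam t - k) * p t) -> (forall t, q2 t = (lam t - k) * q t) ->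
  (forall t, r2 t = - (lam t + k) * r t) ->
  (forall t, s2 t = - (lam t + k) * s t) ->
  (forall t, p t ^+ 2 + q t ^+ 2 - (r t ^+ 2 + s t ^+ 2) = 4) ->
  exists K l1 l2 f1 f2, [/\ 0 <= l1, 0 <= l2 &
    radial k K l1 l2
      (fun t => (p t ^+ 2 + q t ^+ 2 + (r t ^+ 2 + s t ^+ 2)) / 2) f1 f2].
Proof.
move=> dp dp1 dq dq1 dr dr1 ds ds1 Ep Eq Er Es det4.
(* First and second derivatives of the constraint. *)
have ddet t : p t * p1 t + q t * q1 t = r t * r1 t + s t * s1 t.
  have h : is_derive t (1 : R)
    (fun t => p t ^+ 2 + q t ^+ 2 - (r t ^+ 2 + s t ^+ 2))
    (2 * (p t * p1 t + q t * q1 t - (r t * r1 t + s t * s1 t))).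
    by apply: is_derive_eq; rewrite /GRing.scale/=; ring.
  have : 'D_1 (fun t => p t ^+ 2 + q t ^+ 2 - (r t ^+ 2 + s t ^+ 2)) t = 0.
    by rewrite (_ : (fun t => _) = cst 4) ?derive_cst//; apply/funext => u.
  rewrite (derive_val (is_derive := h)); lra.
have dddet t : p1 t ^+ 2 + q1 t ^+ 2 + (lam t - k) * (p t ^+ 2 + q t ^+ 2) =
    r1 t ^+ 2 + s1 t ^+ 2 - (lam t + k) * (r t ^+ 2 + s t ^+ 2).
  have hl : is_derive t (1 : R) (fun t => p t * p1 t + q t * q1 t)
    (p1 t ^+ 2 + q1 t ^+ 2 + (lam t - k) * (p t ^+ 2 + q t ^+ 2)).
    by apply: is_derive_eq; rewrite /GRing.scale/= Ep Eq; ring.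
  have hr : is_derive t (1 : R) (fun t => r t * r1 t + s t * s1 t)
    (r1 t ^+ 2 + s1 t ^+ 2 - (lam t + k) * (r t ^+ 2 + s t ^+ 2)).
    by apply: is_derive_eq; rewrite /GRing.scale/= Er Es; ring.
  have E : (fun t => p t * p1 t + q t * q1 t) =
      (fun t => r t * r1 t + s t * s1 t) by apply/funext => u; exact: ddet.
  by rewrite -(derive_val (is_derive := hl)) -(derive_val (is_derive := hr)) E.
(* The three first integrals: energy and the two angular momenta. *)
pose f t := (p t ^+ 2 + q t ^+ 2 + (r t ^+ 2 + s t ^+ 2)) / 2.
pose e t := (p1 t ^+ 2 + q1 t ^+ 2 + (r1 t ^+ 2 + s1 t ^+ 2)) / 2 + k * f t.
have eE t : e t = e 0.
  apply: is_derive_0_is_cst => u.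
  apply: is_derive_eq; rewrite /GRing.scale/= Ep Eq Er Es.
  transitivity (lam u * (p u * p1 u + q u * q1 u - (r u * r1 u + s u * s1 u))).
    by field.
  by rewrite ddet subrr mulr0.
pose m t := p t * q1 t - q t * p1 t.
have mE t : m t = m 0.
  apply: is_derive_0_is_cst => u.
  by apply: is_derive_eq; rewrite /GRing.scale/= Ep Eq; ring.
pose n t := r t * s1 t - s t * r1 t.
have nE t : n t = n 0.
  apply: is_derive_0_is_cst => u.
  by apply: is_derive_eq; rewrite /GRing.scale/= Er Es; ring.
exists (e 0), (m 0 ^+ 2), (n 0 ^+ 2), (fun t => 2 * (p t * p1 t + q t * q1 t)),
  (fun t => 2 * (p1 t ^+ 2 + q1 t ^+ 2) + 2 * (lam t - k) * (p t ^+ 2 + q t ^+ 2)).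
(* By Lagrange's identity the squared angular momenta are polynomials in the
   squared radii [U], [W], the squared speeds [X], [Y] and the half derivative
   [g] of the squared radii, which is common to both motions. *)
pose U t := p t ^+ 2 + q t ^+ 2; pose W t := r t ^+ 2 + s t ^+ 2.
pose X t := p1 t ^+ 2 + q1 t ^+ 2; pose Y t := r1 t ^+ 2 + s1 t ^+ 2.
pose g t := p t * p1 t + q t * q1 t.
have UW t : U t = W t + 4 by have := det4 t; rewrite /U /W; lra.
have fU t : f t = (U t + W t) / 2 by [].
have lagrange_m t : (p t * q1 t - q t * p1 t) ^+ 2 = U t * X t - g t ^+ 2.
  by rewrite /U /X /g; ring.
have lagrange_n t : (r t * s1 t - s t * r1 t) ^+ 2 = W t * Y t - g t ^+ 2.
  by rewrite /g ddet /W /Y; ring.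
split; [exact: sqr_ge0|exact: sqr_ge0|split => t].
- apply: is_derive_eq; rewrite /GRing.scale/=; have := ddet t; nra.
- by apply: is_derive_eq; rewrite /GRing.scale/= Ep Eq; ring.
- have := det4 t; have := sqr_ge0 (r t); have := sqr_ge0 (s t); lra.
- rewrite -/(f t) -(eE t) /e; have := sqr_ge0 (r1 t); have := sqr_ge0 (s1 t).
  have := sqr_ge0 (p1 t); have := sqr_ge0 (q1 t); lra.
- rewrite -(eE t) -(mE t) -(nE t) /cubic /e /m /n fU lagrange_m lagrange_n.
  have -> : p1 t ^+ 2 + q1 t ^+ 2 + (r1 t ^+ 2 + s1 t ^+ 2) = X t + Y t by [].
  have -> : p t ^+ 2 + q t ^+ 2 + (r t ^+ 2 + s t ^+ 2) = U t + W t by [].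
  have -> : p t * p1 t + q t * q1 t = g t by [].
  by rewrite UW; field.
- rewrite -(eE t) -(mE t) -(nE t) /dcubic /e /m /n fU lagrange_m lagrange_n.
  have -> : p1 t ^+ 2 + q1 t ^+ 2 + (r1 t ^+ 2 + s1 t ^+ 2) = X t + Y t by [].
  have -> : p t ^+ 2 + q t ^+ 2 + (r t ^+ 2 + s t ^+ 2) = U t + W t by [].
  have -> : p t * p1 t + q t * q1 t = g t by [].
  (* The second derivative of the constraint eliminates [lam]. *)
  have E := dddet t; rewrite -/(X t) -/(Y t) -/(U t) -/(W t) UW in E *.
  have -> : X t = Y t - (lam t + k) * W t - (lam t - k) * (W t + 4) by lra.
  by field.
Qed.

Lemma is_derive_mx_entry {R : realType} {m n : nat} {M : R -> 'M[R]_(m, n)}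
    {t : R} i j : derivable M t 1 ->
  is_derive t (1 : R) (fun s => M s i j) ((M^`())%classic t i j).
Proof.
move=> dM; rewrite derive1E derive_mx// mxE; apply: derivableP.
exact: (derivable_mxP _ _ _).1.
Qed.

Lemma sum_ord2 {V : nmodType} (F : 'I_2 -> V) : \sum_i F i = F 0 + F 1.
Proof.
by rewrite big_ord_recl big_ord1; congr (_ + F _); exact: val_inj.
Qed.

Lemma det_mx2E {R : realType} (A : 'M[R]_2) :
  \det A = A 0 0 * A 1 1 - A 0 1 * A 1 0.
Proof.
rewrite (expand_det_row _ 0) sum_ord2 /cofactor !det_mx11 !mxE /=.
have -> : lift 0 0 = 1 :> 'I_2 by exact: val_inj.
have -> : lift 1 0 = 0 :> 'I_2 by exact: val_inj.
by rewrite expr0 expr1; ring.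
Qed.

Lemma cofE {R : realType} (A : 'M[R]_2) :
  ((cof A 0 0 = A 1 1) * (cof A 0 1 = - A 1 0) *
   (cof A 1 0 = - A 0 1) * (cof A 1 1 = A 0 0))%type.
Proof.
by do !split; rewrite /cof !(mxE, sum_ord2)/=; ring.
Qed.

(** The squared norm in the coordinates that diagonalize [cof]. *)
Lemma frobE {R : realType} (A : 'M[R]_2) :
  frob A = Num.sqrt (((A 0 0 + A 1 1) ^+ 2 + (A 1 0 - A 0 1) ^+ 2 +
    ((A 0 0 - A 1 1) ^+ 2 + (A 0 1 + A 1 0) ^+ 2)) / 2).
Proof.
by rewrite /frob /mxtrace !(mxE, sum_ord2); congr Num.sqrt; field.
Qed.

Lemma frob_sqr_radial {R : realType} {kappa : R} {A : R -> 'M[R]_2} :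
  (forall t, SL2 (A t)) -> C2 A -> solution kappa A ->
  exists K l1 l2 f1 f2, [/\ 0 <= l1, 0 <= l2 &
    radial kappa K l1 l2 (fun t => frob (A t) ^+ 2) f1 f2].
Proof.
move=> hSL [_ dA _ dA1 _] [lam [_ ode]].
pose D1 t i j := is_derive_mx_entry i j (dA t).
pose D2 t i j := is_derive_mx_entry i j (dA1 t).
have odeE t i j : (A^`(2))%classic t i j =
    lam t * cof (A t) i j - kappa * A t i j.
  by have /matrixP/(_ i j) := ode t; rewrite !mxE => <-; ring.
have [|||||K [l1 [l2 [f1 [f2 [l10 l20 rf]]]]]] := @central_motion_radial R kappa
  (fun t => A t 0 0 + A t 1 1) (fun t => (A^`())%classic t 0 0 + (A^`())%classic t 1 1)
  (fun t => (A^`(2))%classic t 0 0 + (A^`(2))%classic t 1 1)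
  (fun t => A t 1 0 - A t 0 1) (fun t => (A^`())%classic t 1 0 - (A^`())%classic t 0 1)
  (fun t => (A^`(2))%classic t 1 0 - (A^`(2))%classic t 0 1)
  (fun t => A t 0 0 - A t 1 1) (fun t => (A^`())%classic t 0 0 - (A^`())%classic t 1 1)
  (fun t => (A^`(2))%classic t 0 0 - (A^`(2))%classic t 1 1)
  (fun t => A t 0 1 + A t 1 0) (fun t => (A^`())%classic t 0 1 + (A^`())%classic t 1 0)
  (fun t => (A^`(2))%classic t 0 1 + (A^`(2))%classic t 1 0) lam
  (fun t => is_deriveD (D1 t 0 0) (D1 t 1 1))
  (fun t => is_deriveD (D2 t 0 0) (D2 t 1 1))
  (fun t => is_deriveB (D1 t 1 0) (D1 t 0 1))
  (fun t => is_deriveB (D2 t 1 0) (D2 t 0 1))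
  (fun t => is_deriveB (D1 t 0 0) (D1 t 1 1))
  (fun t => is_deriveB (D2 t 0 0) (D2 t 1 1))
  (fun t => is_deriveD (D1 t 0 1) (D1 t 1 0))
  (fun t => is_deriveD (D2 t 0 1) (D2 t 1 0)).
- by move=> t; rewrite !odeE !cofE; ring.
- by move=> t; rewrite !odeE !cofE; ring.
- by move=> t; rewrite !odeE !cofE; ring.
- by move=> t; rewrite !odeE !cofE; ring.
- move=> t; have := hSL t; rewrite /SL2/= det_mx2E => E.
  transitivity (4 * (A t 0 0 * A t 1 1 - A t 0 1 * A t 1 0)); first by ring.
  by rewrite E mulr1.
- exists K, l1, l2, f1, f2; split => //; move: rf.
  set F := (X in radial _ _ _ _ X) => rf.
  suff -> : (fun t => frob (A t) ^+ 2) = F by [].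
  apply/funext => t; rewrite frobE sqr_sqrtr//.
  by rewrite divr_ge0// !addr_ge0// sqr_ge0.
Qed.

Theorem theorem11p1 (R : realType) (kappa : R) (hkappa : 0 < kappa)
    (A : R -> 'M[R]_2) (hSL : forall t, SL2 (A t)) (hC2 : C2 A)
    (hsol : solution kappa A) :
  [\/ rigid A,
      ~ constant_fun (fun t => frob (A t)) /\
        (exists T : R, 0 < T /\ periodic (fun t => frob (A t)) T)
    | (forall t, Num.sqrt 2 < frob (A t)) /\
        decreases_to_pinfty (fun t => frob (A t)) (Num.sqrt 2) /\
        decreases_to_ninfty (fun t => frob (A t)) (Num.sqrt 2)].
Proof.
have [K [l1 [l2 [f1 [f2 [l10 l20]]]]]] := frob_sqr_radial hSL hC2 hsol.
set f := (fun t => frob (A t) ^+ 2) => rf.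
have frobf t : frob (A t) = Num.sqrt (f t).
  by rewrite /f sqrtr_sqr ger0_norm// sqrtr_ge0.
have f0 t : 0 < f t by rewrite (lt_le_trans _ (radial_ge2 rf t)).
have [|nr] := EM (rigid A); first by constructor 1.
have [[T T0 fT]|[gt2 fy fNy [M [dec inc]]]] :=
  radial_dichotomy hkappa l10 l20 rf.
  constructor 2; split; first exact: nr.
  by exists T; split => // t; rewrite !frobf fT.
have frobfE : (fun t => frob (A t)) = (fun t => Num.sqrt (f t)).
  by apply/funext.
have sqrt_cont : {for (2 : R), continuous (@Num.sqrt R)}.
  exact: sqrt_continuous.
constructor 3; split; first by move=> t; rewrite frobf ltr_sqrt.
rewrite frobfE; split; split.
- exact: (cvg_comp _ _ fy).
- by exists M => s t /ltW Ms st; rewrite ltr_sqrt// dec.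
- exact: (cvg_comp _ _ fNy).
- by exists M => s t /ltW tM st; rewrite ltr_sqrt// inc.
Qed.
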